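(* Let $H$ be a Hadamard manifold, $E\subseteq H$ a nonempty open geodesic convex set, $\phi_s:E\to\mathbb{I}$, $\phi_s(p)=[\phi_s^L(p),\phi_s^U(p)]$, $s\in\{1,\dots,l\}$, and $\psi_u:E\to\mathbb{R}$, $u\in\{1,\dots,t\}$, $F=\{p\in E:\psi_u(p)\le0,\ u=1,\dots,t\}$, and consider the problem (MIVOP2) of minimizing $\phi=(\phi_1,\dots,\phi_l)$ over $F$. Let $\bar p\in F$ and let each $\psi_u$ be convex and directionally differentiable at $\bar p$. (a) If there exists $c\in\{1,\dots,l\}$ such that $\phi_c$ is LU-convex and weakly directionally differentiable at $\bar p$, and there exist real numbers $\lambda^L>0,\lambda^U>0$ and $\mu_u\ge0$, $u\in\{1,\dots,t\}$, such that (i) $\lambda^L(\phi_c^L)'(\bar p;\exp_{\bar p}^{-1}p)+\lambda^U(\phi_c^U)'(\bar p;\exp_{\bar p}^{-1}p)+\sum_{u=1}^{t}\mu_u\psi_u'(\bar p;\exp_{\bar p}^{-1}p)\ge0$ for all $p\in F$; (ii) $\mu_u\psi_u(\bar p)=0$, $u\in\{1,\dots,t\}$, then $\bar p$ is a weakly type-I Pareto optimal solution of (MIVOP2). (b) If there exists $c\in\{1,\dots,l\}$ such that $\phi_c$ is CW-convex and weakly directionally differentiable at $\bar p$, and there exist real numbers $\lambda^C>0,\lambda^W>0$ and $\mu_u\ge0$, $u\in\{1,\dots,t\}$, such that (iii) $\lambda^C(\phi_c^C)'(\bar p;\exp_{\bar p}^{-1}p)+\lambda^W(\phi_c^W)'(\bar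 p;\exp_{\bar p}^{-1}p)+\sum_{u=1}^{t}\mu_u\psi_u'(\bar p;\exp_{\bar p}^{-1}p)\ge0$ for all $p\in F$; (iv) $\mu_u\psi_u(\bar p)=0$, $u\in\{1,\dots,t\}$, then $\bar p$ is a weakly type-II Pareto optimal solution of (MIVOP2). (c) If there exists $c\in\{1,\dots,l\}$ such that $\phi_c$ is CW-convex and weakly directionally differentiable at $\bar p$, and there exist real numbers $\lambda^L>0,\lambda^U>0$ and $\mu_u\ge0$, $u\in\{1,\dots,t\}$, such that (v) $\lambda^L<\lambda^U$; (vi) $\lambda^L(\phi_c^L)'(\bar p;\exp_{\bar p}^{-1}p)+\lambda^U(\phi_c^U)'(\bar p;\exp_{\bar p}^{-1}p)+\sum_{u=1}^{t}\mu_u\psi_u'(\bar p;\exp_{\bar p}^{-1}p)\ge0$ for all $p\in F$; (vii) $\mu_u\psi_u(\bar p)=0$, $u\in\{1,\dots,t\}$, then $\bar p$ is a weakly type-II Pareto optimal solution of (MIVOP2).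
   Context: A Hadamard manifold $H$ is a complete simply connected Riemannian manifold of non-positive sectional curvature; for $p\in H$ the map $\exp_p:T_p(H)\to H$ is a diffeomorphism with inverse $\exp_p^{-1}$, and the geodesic joining $p$ to $q$ is $\gamma_{p,q}(\alpha)=\exp_p(\alpha\exp_p^{-1}q)$, $\alpha\in[0,1]$. A set $E\subseteq H$ is geodesic convex if $\gamma_{p,q}(\alpha)\in E$ for all $p,q\in E$, $\alpha\in[0,1]$. The feasible set $F$ is assumed geodesic convex. For $f:E\to\mathbb{R}$, the directional derivative is $f'(p;w)=\lim_{\alpha\to0^+}\frac{f(\exp_p(\alpha w))-f(p)}{\alpha}$, $w\in T_p(H)$; $f$ is directionally differentiable at $p$ if it exists (finite) for all $w\in T_p(H)$. $f$ is convex at $p\in E$ if $f(\gamma_{p,q}(\alpha))\le\alpha f(q)+(1-\alpha)f(p)$ for all $q\in E$, $\alpha\in[0,1]$. $\mathbb{I}$ is the set of closed bounded intervals of $\mathbb{R}$. For $T=[t^L,t^U]$, $S=[s^L,s^U]$: $T+S=[t^L+s^L,t^U+s^U]$, and $kT=[kt^L,kt^U]$ for $k\ge0$; $t^C=\frac12(t^L+t^U)$ and $t^W=\frac12(t^U-t^L)$. $T\leqq_{LU}S$ iff $t^L\le s^L$ and $t^U\le s^U$; $T\leqq_{CW}S$ iff $t^C\le s^C$ and $t^W\le s^W$; for either order, $T<S$ means $T\leqq S$ and $T\ne S$. For $f=[f^L,f^U]:E\to\mathbb{I}$ put $f^C=\frac12(f^L+f^U)$, $f^W=\frac12(f^U-f^L)$.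 $f$ is weakly directionally differentiable at $p$ if $f^L$ and $f^U$ are directionally differentiable at $p$. $f$ is LU-convex (resp. CW-convex) at $p$ if for all $q\in E$, $\alpha\in[0,1]$: $f(\gamma_{p,q}(\alpha))\leqq_{LU}(1-\alpha)f(p)+\alpha f(q)$ (resp. with $\leqq_{CW}$). $\bar p\in F$ is a weakly type-I (resp. weakly type-II) Pareto optimal solution of (MIVOP2) if there is no $\hat p\in F$ with $\phi_s(\hat p)<_{LU}\phi_s(\bar p)$ (resp. $\phi_s(\hat p)<_{CW}\phi_s(\bar p)$) for all $s\in\{1,\dots,l\}$. *)

(* Defs.v *)
From HB Require Import structures.
From mathcomp Require Import all_boot all_order all_algebra.
From mathcomp Require Import all_classical all_reals all_analysis.

Set Implicit Arguments.
Unset Strict Implicit.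
Unset Printing Implicit Defensive.

Import Order.TTheory GRing.Theory Num.Theory.
Import numFieldNormedType.Exports.

Local Open Scope classical_set_scope.
Local Open Scope ring_scope.

(** * Smooth manifolds *)

Section Smooth.
Context {R : realType} {n : nat}.
Implicit Types (f : 'rV[R]_n -> R) (x : 'rV[R]_n) (U : set 'rV[R]_n).

Definition partial (i : 'I_n) f : 'rV[R]_n -> R :=
  fun x => 'D_(delta_mx 0 i) f x.

Definition iter_partial (s : seq 'I_n) f : 'rV[R]_n -> R := foldr partial f s.

(* C^oo on an open set: partial derivatives of all orders exist and are
   continuous there. *)
Definition smooth_on U f : Prop :=
  forall (s : seq 'I_n) x, U x ->
    {for x, continuous (iter_partial s f)} /\
    forall i, derivable (iter_partial s f) x (delta_mx 0 i).

End Smooth.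

(* The atlas is indexed by the points of the manifold, [chart c] being a chart
   around [c]; every atlas has such a subatlas, defining the same smooth
   structure.  [chart c] and [chart_inv c] are only meaningful on
   [chart_dom c] and on its image, respectively. *)
Record smoothManifold (R : realType) (n : nat) := SmoothManifold {
  carrier :> topologicalType ;
  carrier_hausdorff : hausdorff_space carrier ;
  carrier_second_countable : @second_countable carrier ;
  chart_dom : carrier -> set carrier ;
  chart : carrier -> carrier -> 'rV[R]_n ;
  chart_inv : carrier -> 'rV[R]_n -> carrier ;
  chart_dom_center : forall c, chart_dom c c ;
  chart_dom_open : forall c, open (chart_dom c) ;
  chart_img_open : forall c, open (chart c @` chart_dom c) ;
  chartK : forall c q, chart_dom c q -> chart_inv c (chart c q) = q ;
  chart_continuous : forall c q, chart_dom c q ->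
    {for q, continuous (chart c)} ;
  chart_inv_continuous : forall c x, (chart c @` chart_dom c) x ->
    {for x, continuous (chart_inv c)} ;
  transition_smooth : forall c d (j : 'I_n),
    smooth_on (chart c @` (chart_dom c `&` chart_dom d))
      (fun x => chart d (chart_inv c x) 0 j)
}.

(* A tangent vector at p is represented by its coordinates in [chart p]. *)
Definition tangent (R : realType) (n : nat) (M : smoothManifold R n) (p : M)
  : vectType R := 'rV[R]_n.

(** * Riemannian metrics *)

(* If G q is the Gram matrix, in the coordinates of [chart q], of an inner
   product on the tangent space at q, then [gram G c x] is the Gram matrix, in
   the coordinates of [chart c], of the inner product at the point of
   coordinates x: row vectors v in the chart c become v *m J in [chart q]. *)
Definition gram (R : realType) (n : nat) (M : smoothManifold R n)
    (G : M -> 'M[R]_n) (c : M) (x : 'rV[R]_n) : 'M[R]_n :=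
  let q := chart_inv c x in
  let J := 'J (chart q \o chart_inv c) x in
  J *m G q *m J^T.

Record riemannianManifold (R : realType) (n : nat) := RiemannianManifold {
  manifold :> smoothManifold R n ;
  metric : manifold -> 'M[R]_n ;
  metric_sym : forall p, (metric p)^T = metric p ;
  metric_pos : forall p (v : 'rV[R]_n), v != 0 ->
    0 < (v *m metric p *m v^T) 0 0 ;
  metric_smooth : forall c (i j : 'I_n),
    smooth_on (chart c @` chart_dom c) (fun x => gram metric c x i j)
}.

Section Riemannian.
Context {R : realType} {n : nat} (M : riemannianManifold R n).
Implicit Types (c p q : M) (x : 'rV[R]_n) (i j k l m : 'I_n).

Definition inner p (u v : tangent p) : R :=
  ((u : 'rV[R]_n) *m metric p *m (v : 'rV[R]_n)^T) 0 0.

(* [christoffel c k i j] is Gamma^k_ij in the chart c. *)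
Definition christoffel c k i j : 'rV[R]_n -> R := fun x =>
  let g a b := fun y => gram (@metric R n M) c y a b in
  2^-1 * \sum_l invmx (gram (@metric R n M) c x) k l *
    (partial i (g j l) x + partial j (g i l) x - partial l (g i j) x).

(* [riemann c l k i j x] is the component on d_l of R(d_i, d_j) d_k, for
   R(X, Y)Z = nabla_X nabla_Y Z - nabla_Y nabla_X Z - nabla_[X, Y] Z. *)
Definition riemann c l k i j x : R :=
  partial i (christoffel c l j k) x - partial j (christoffel c l i k) x
  + \sum_m (christoffel c l i m x * christoffel c m j k x
            - christoffel c l j m x * christoffel c m i k x).

(* R(u, v)w *)
Definition curvature p (u v w : tangent p) : tangent p :=
  \row_l \sum_i \sum_j \sum_k riemann p l k i j (chart p p) *
    (u : 'rV[R]_n) 0 i * (v : 'rV[R]_n) 0 j * (w : 'rV[R]_n) 0 k.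

Definition sectional_curvature p (u v : tangent p) : R :=
  inner (curvature u v v) u / (inner u u * inner v v - inner u v ^+ 2).

Definition nonpositive_curvature : Prop :=
  forall p (u v : tangent p), free [:: u; v] -> sectional_curvature u v <= 0.

(** * Geodesics and the exponential map *)

Definition geodesic (g : R -> M) : Prop :=
  continuous g /\
  forall c t, chart_dom c (g t) ->
    let y : R -> 'rV[R]_n := chart c \o g in
    [/\ derivable y t 1, derivable (derive1 y) t 1 &
        forall k, derive1 (derive1 y) t 0 k
          + \sum_i \sum_j christoffel c k i j (y t)
              * derive1 y t 0 i * derive1 y t 0 j = 0].

Definition geodesic_from p (v : tangent p) (g : R -> M) : Prop :=
  [/\ geodesic g, g 0 = p & derive1 (chart p \o g) 0 = v].

Definition geodesically_complete : Prop :=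
  forall p (v : tangent p), exists g, geodesic_from v g.

(* The default value p is irrelevant on a complete manifold. *)
Definition exp p (v : tangent p) : M :=
  xget p [set q | exists2 g, geodesic_from v g & g 1 = q].

(* The inverse of [exp p], by choice; on a Hadamard manifold the set below is
   a singleton. *)
Definition exp_inv p q : tangent p :=
  xget 0 [set v | exp v = q].

(** * Hadamard manifolds *)

Definition path_connected : Prop :=
  forall p q, exists f : R -> M,
    [/\ {within `[0, 1], continuous f}, f 0 = p & f 1 = q].

Definition simply_connected : Prop :=
  path_connected /\
  forall f : R -> M, {within `[0, 1], continuous f} -> f 0 = f 1 ->
    exists h : R * R -> M,
      {within `[0, 1] `*` `[0, 1], continuous h} /\
      forall t : R, 0 <= t <= 1 ->
        [/\ h (t, 0) = f t, h (t, 1) = f 0, h (0, t) = f 0 & h (1, t) = f 0].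

Definition hadamard : Prop :=
  [/\ geodesically_complete, simply_connected & nonpositive_curvature].

(** * Convexity and directional derivatives *)

(* The geodesic joining p to q. *)
Definition geo p q (a : R) : M := exp (a *: exp_inv p q).

Definition geodesic_convex (E : set M) : Prop :=
  forall p q, E p -> E q -> forall a, 0 <= a -> a <= 1 -> E (geo p q a).

(* Functions on a set E are represented by total functions on M; for E open
   and p in E, the directional derivatives at p only depend on the values
   on E. *)
Definition dir_quotient (f : M -> R) p (w : tangent p) (a : R) : R :=
  (f (exp (a *: w)) - f p) / a.

Definition dir_derive (f : M -> R) p (w : tangent p) : R :=
  lim (dir_quotient f w a @[a --> 0^'+]).

Definition dir_differentiable (f : M -> R) p : Prop :=
  forall w : tangent p, cvg (dir_quotient f w a @[a --> 0^'+]).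

Definition convex_at (E : set M) (f : M -> R) p : Prop :=
  forall q, E q -> forall a, 0 <= a -> a <= 1 ->
    f (geo p q a) <= a * f q + (1 - a) * f p.

End Riemannian.

(** * Closed bounded intervals *)

Section Intervals.
Context {R : realType}.

Record cintv := CIntv {
  intv_lo : R ;
  intv_hi : R ;
  intv_lo_le_hi : intv_lo <= intv_hi
}.
Implicit Types T S : cintv.

Definition intv_add T S : cintv :=
  CIntv (lerD (intv_lo_le_hi T) (intv_lo_le_hi S)).

Definition intv_scale (k : R) (k0 : 0 <= k) T : cintv :=
  CIntv (ler_wpM2l k0 (intv_lo_le_hi T)).

Definition intv_center T : R := 2^-1 * (intv_lo T + intv_hi T).
Definition intv_halfwidth T : R := 2^-1 * (intv_hi T - intv_lo T).

Definition leLU T S : Prop := intv_lo T <= intv_lo S /\ intv_hi T <= intv_hi S.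
Definition leCW T S : Prop :=
  intv_center T <= intv_center S /\ intv_halfwidth T <= intv_halfwidth S.
Definition ltLU T S : Prop := leLU T S /\ T <> S.
Definition ltCW T S : Prop := leCW T S /\ T <> S.

End Intervals.
Arguments cintv : clear implicits.

Section IntervalValued.
Context {R : realType} {n : nat} (M : riemannianManifold R n).
Implicit Types (p q : M) (E : set M) (f : M -> cintv R).

Definition weakly_dir_differentiable f p : Prop :=
  dir_differentiable (intv_lo \o f) p /\ dir_differentiable (intv_hi \o f) p.

Definition intv_convex_at (le : cintv R -> cintv R -> Prop) E f p : Prop :=
  forall q, E q -> forall a (a0 : 0 <= a) (a1 : 0 <= 1 - a),
    le (f (geo p q a)) (intv_add (intv_scale a1 (f p)) (intv_scale a0 (f q))).

Definition LU_convex_at := intv_convex_at leLU.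
Definition CW_convex_at := intv_convex_at leCW.

(** * The optimization problem *)

Definition feasible (t : nat) E (psi : 'I_t -> M -> R) : set M :=
  [set p | E p /\ forall u, psi u p <= 0].

Definition weakly_typeI_Pareto (l : nat) (F : set M)
    (phi : 'I_l -> M -> cintv R) p : Prop :=
  F p /\ ~ exists2 q, F q & forall s, ltLU (phi s q) (phi s p).

Definition weakly_typeII_Pareto (l : nat) (F : set M)
    (phi : 'I_l -> M -> cintv R) p : Prop :=
  F p /\ ~ exists2 q, F q & forall s, ltCW (phi s q) (phi s p).

End IntervalValued.

(* Main.v *)
Require Import Defs.
From HB Require Import structures.
From mathcomp Require Import all_boot all_order all_algebra.
From mathcomp Require Import all_classical all_reals all_analysis.
From mathcomp Require Import ring lra.

Import Order.TTheory GRing.Theory Num.Theory.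
Import numFieldNormedType.Exports.

Local Open Scope classical_set_scope.
Local Open Scope ring_scope.

(** If [f] is convex at [p], then along the geodesic
    from [p] to [q] every difference quotient of step at most 1 is bounded by
    [f q - f p], hence so is the directional derivative towards [q]
    ([dir_derive_le_sub]).  A stationarity condition with nonnegative weights
    therefore turns into an inequality between values: for feasible [q], the
    constraint terms contribute at most the sum of [mu u * psi u q], which is
    nonpositive, where complementarity removes the values at [p].  What remains
    is that the weighted sum of the two objectives at [p] is at most the one at
    [q] ([stationary_weighted_le]).

    A point [q] that dominates [p] makes both objectives of each component no
    larger and, intervals being determined by either pair of parameters, at
    least one of them strictly smaller.  Positive weights make the weighted sum
    strictly smaller, a contradiction.  This settles (a) with the endpoints and
    (b) with the center and the half-width as objectives.

    For (c), the identity
    [a * lo + b * hi = (a + b) * center + (b - a) * halfwidth] passes to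
    directional derivatives by linearity, and [a < b] makes both new weights
    positive, so that (c) is an instance of (b). *)

(** * Directional derivatives *)

Section DirectionalDerivatives.
Context {R : realType} {n : nat} {M : riemannianManifold R n}.
Implicit Types (f g : M -> R) (p q : M) (a b : R).

Lemma dir_quotient_lin f g h a b p (w : tangent p) :
  (forall x, h x = a * f x + b * g x) ->
  dir_quotient h w = (fun s => a * dir_quotient f w s + b * dir_quotient g w s).
Proof.
move=> hE; apply/funext => s; rewrite /dir_quotient !hE.
by rewrite !mulrA -mulrDl; congr (_ / _); ring.
Qed.

Lemma dir_differentiable_lin f g h a b p :
  (forall x, h x = a * f x + b * g x) ->
  dir_differentiable f p -> dir_differentiable g p -> dir_differentiable h p.
Proof.
move=> hE df dg w; rewrite (dir_quotient_lin _ _ _ _ _ _ _ hE).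
by apply: is_cvgD; apply: is_cvgMl_tmp; [exact: df|exact: dg].
Qed.

Lemma dir_derive_lin f g h a b p (w : tangent p) :
  (forall x, h x = a * f x + b * g x) ->
  dir_differentiable f p -> dir_differentiable g p ->
  dir_derive h w = a * dir_derive f w + b * dir_derive g w.
Proof.
move=> hE df dg; rewrite /dir_derive (dir_quotient_lin _ _ _ _ _ _ _ hE).
apply: cvg_lim => //.
by apply: cvgD; apply: cvgMl_tmp; [exact: df|exact: dg].
Qed.

(** Convexity bounds the difference quotients of every step in ]0, 1], and the
    bound survives the passage to the limit. *)
Lemma dir_derive_le_sub (E : set M) f p q :
  convex_at E f p -> dir_differentiable f p -> E q ->
  dir_derive f (exp_inv p q) <= f q - f p.
Proof.
move=> cf df Eq; apply: limr_le; first exact: df.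
near=> s.
have s0 : 0 < s by near: s; exact: nbhs_right_gt.
have s1 : s <= 1 by near: s; exact: nbhs_right_le.
rewrite /dir_quotient ler_pdivrMr //.
by have := cf q Eq s (ltW s0) s1; rewrite /geo; lra.
Unshelve. all: by end_near.
Qed.

(** Stationarity towards a single feasible point [q] already compares the values
    at [p] and [q]: by convexity each derivative is at most an increment, and
    complementarity leaves only nonpositive constraint terms. *)
Lemma stationary_weighted_le (E : set M) t (psi : 'I_t -> M -> R) f g p q
    a b (mu : 'I_t -> R) :
  convex_at E f p -> dir_differentiable f p ->
  convex_at E g p -> dir_differentiable g p ->
  (forall u, convex_at E (psi u) p) ->
  (forall u, dir_differentiable (psi u) p) ->
  0 <= a -> 0 <= b -> (forall u, 0 <= mu u) ->
  (forall u, mu u * psi u p = 0) ->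
  feasible E psi q ->
  0 <= a * dir_derive f (exp_inv p q) + b * dir_derive g (exp_inv p q)
     + \sum_(u < t) mu u * dir_derive (psi u) (exp_inv p q) ->
  a * f p + b * g p <= a * f q + b * g q.
Proof.
move=> cf df cg dg cpsi dpsi a0 b0 mu0 compl [Eq psiq] stat.
have lef : a * dir_derive f (exp_inv p q) <= a * (f q - f p).
  by rewrite ler_wpM2l // (@dir_derive_le_sub E).
have leg : b * dir_derive g (exp_inv p q) <= b * (g q - g p).
  by rewrite ler_wpM2l // (@dir_derive_le_sub E).
have lepsi : \sum_(u < t) mu u * dir_derive (psi u) (exp_inv p q) <= 0.
  apply: sumr_le0 => u _.
  apply: (@le_trans _ _ (mu u * (psi u q - psi u p))).
    by rewrite ler_wpM2l // (@dir_derive_le_sub E).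
  by rewrite mulrBr compl subr0 mulr_ge0_le0.
by rewrite !mulrBr in lef leg; lra.
Qed.

End DirectionalDerivatives.

(** * Intervals and their two parametrizations *)

Section IntervalParameters.
Context {R : realType}.
Implicit Types (T S : cintv R) (a b : R).

Lemma intv_eq T S :
  intv_lo T = intv_lo S -> intv_hi T = intv_hi S -> T = S.
Proof.
case: T S => [tl tu le_t] [sl su le_s] /= eqL eqU; subst sl su.
by rewrite (bool_irrelevance le_t le_s).
Qed.

Lemma intv_eqCW T S :
  intv_center T = intv_center S -> intv_halfwidth T = intv_halfwidth S -> T = S.
Proof.
by rewrite /intv_center /intv_halfwidth => eqC eqW; apply: intv_eq; lra.
Qed.

Lemma weighted_lt a b (x y x' y' : R) :
  0 < a -> 0 < b -> x <= x' -> y <= y' -> ~ (x = x' /\ y = y') ->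
  a * x + b * y < a * x' + b * y'.
Proof.
move=> a0 b0 lex ley neq.
move: lex; rewrite le_eqVlt => /orP[/eqP eqx|ltx]; last first.
  by rewrite ltr_leD // ?ltr_pM2l // ler_pM2l.
move: ley; rewrite le_eqVlt => /orP[/eqP eqy|lty]; first by case: neq.
by rewrite eqx ltrD2l ltr_pM2l.
Qed.

Lemma ltLU_weighted a b T S : 0 < a -> 0 < b -> ltLU T S ->
  a * intv_lo T + b * intv_hi T < a * intv_lo S + b * intv_hi S.
Proof.
by move=> a0 b0 [[leL leU] neq]; apply: weighted_lt => // -[? ?]; exact/neq/intv_eq.
Qed.

Lemma ltCW_weighted a b T S : 0 < a -> 0 < b -> ltCW T S ->
  a * intv_center T + b * intv_halfwidth T
    < a * intv_center S + b * intv_halfwidth S.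
Proof.
move=> a0 b0 [[leC leW] neq].
by apply: weighted_lt => // -[? ?]; exact/neq/intv_eqCW.
Qed.

End IntervalParameters.

(** * Interval-valued functions *)

Section IntervalValuedFunctions.
Context {R : realType} {n : nat} {M : riemannianManifold R n}.
Implicit Types (E : set M) (f : M -> cintv R) (p : M).

Lemma LU_convex_lo E f p : LU_convex_at E f p -> convex_at E (intv_lo \o f) p.
Proof.
move=> cf q Eq a a0 a1; have a1' : 0 <= 1 - a by rewrite subr_ge0.
by have [+ _] := cf q Eq a a0 a1'; rewrite /= addrC.
Qed.

Lemma LU_convex_hi E f p : LU_convex_at E f p -> convex_at E (intv_hi \o f) p.
Proof.
move=> cf q Eq a a0 a1; have a1' : 0 <= 1 - a by rewrite subr_ge0.
by have [_ +] := cf q Eq a a0 a1'; rewrite /= addrC.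
Qed.

Lemma CW_convex_center E f p :
  CW_convex_at E f p -> convex_at E (intv_center \o f) p.
Proof.
move=> cf q Eq a a0 a1; have a1' : 0 <= 1 - a by rewrite subr_ge0.
by have [+ _] := cf q Eq a a0 a1'; rewrite /intv_center /=; lra.
Qed.

Lemma CW_convex_halfwidth E f p :
  CW_convex_at E f p -> convex_at E (intv_halfwidth \o f) p.
Proof.
move=> cf q Eq a a0 a1; have a1' : 0 <= 1 - a by rewrite subr_ge0.
by have [_ +] := cf q Eq a a0 a1'; rewrite /intv_halfwidth /=; lra.
Qed.

Lemma center_lin f x : (intv_center \o f) x =
  2^-1 * (intv_lo \o f) x + 2^-1 * (intv_hi \o f) x.
Proof. by rewrite /intv_center /= mulrDr. Qed.

Lemma halfwidth_lin f x : (intv_halfwidth \o f) x =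
  (- 2^-1) * (intv_lo \o f) x + 2^-1 * (intv_hi \o f) x.
Proof. by rewrite /intv_halfwidth /=; ring. Qed.

(** The change of weights that turns a stationarity condition on the endpoints
    into one on the center and the half-width. *)
Lemma dir_derive_weightsCW f p (w : tangent p) (a b : R) :
  weakly_dir_differentiable f p ->
  (a + b) * dir_derive (intv_center \o f) w
    + (b - a) * dir_derive (intv_halfwidth \o f) w
  = a * dir_derive (intv_lo \o f) w + b * dir_derive (intv_hi \o f) w.
Proof.
move=> [dL dU].
rewrite (dir_derive_lin _ _ _ _ _ _ _ (center_lin f)) //.
rewrite (dir_derive_lin _ _ _ _ _ _ _ (halfwidth_lin f)) //.
by field.
Qed.

(** Fixing the candidate [q] lets the same lemma serve both stationarity
    conditions for the center-width order, whatever weights they come with. *)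
Lemma stationaryCW_not_dominated E t (psi : 'I_t -> M -> R) f p q
    (a b : R) (mu : 'I_t -> R) :
  (forall u, convex_at E (psi u) p) ->
  (forall u, dir_differentiable (psi u) p) ->
  CW_convex_at E f p -> weakly_dir_differentiable f p ->
  0 < a -> 0 < b -> (forall u, 0 <= mu u) ->
  (forall u, mu u * psi u p = 0) ->
  feasible E psi q ->
  0 <= a * dir_derive (intv_center \o f) (exp_inv p q)
     + b * dir_derive (intv_halfwidth \o f) (exp_inv p q)
     + \sum_(u < t) mu u * dir_derive (psi u) (exp_inv p q) ->
  ~ ltCW (f q) (f p).
Proof.
move=> cpsi dpsi cf [dL dU] a0 b0 mu0 compl Fq stat lt_qp.
have := ltCW_weighted _ _ _ _ a0 b0 lt_qp; apply/negP; rewrite -leNgt.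
apply: (stationary_weighted_le E _ psi (intv_center \o f)
  (intv_halfwidth \o f) p q a b mu) => //; try exact: ltW.
- exact: CW_convex_center.
- exact: (dir_differentiable_lin _ _ _ _ _ _ (center_lin f)).
- exact: CW_convex_halfwidth.
- exact: (dir_differentiable_lin _ _ _ _ _ _ (halfwidth_lin f)).
Qed.

Lemma stationaryLU_not_dominated E t (psi : 'I_t -> M -> R) f p q
    (a b : R) (mu : 'I_t -> R) :
  (forall u, convex_at E (psi u) p) ->
  (forall u, dir_differentiable (psi u) p) ->
  LU_convex_at E f p -> weakly_dir_differentiable f p ->
  0 < a -> 0 < b -> (forall u, 0 <= mu u) ->
  (forall u, mu u * psi u p = 0) ->
  feasible E psi q ->
  0 <= a * dir_derive (intv_lo \o f) (exp_inv p q)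
     + b * dir_derive (intv_hi \o f) (exp_inv p q)
     + \sum_(u < t) mu u * dir_derive (psi u) (exp_inv p q) ->
  ~ ltLU (f q) (f p).
Proof.
move=> cpsi dpsi cf [dL dU] a0 b0 mu0 compl Fq stat lt_qp.
have := ltLU_weighted _ _ _ _ a0 b0 lt_qp; apply/negP; rewrite -leNgt.
apply: (stationary_weighted_le E _ psi (intv_lo \o f)
  (intv_hi \o f) p q a b mu) => //; try exact: ltW.
- exact: LU_convex_lo.
- exact: LU_convex_hi.
Qed.

End IntervalValuedFunctions.

(** * Sufficient optimality conditions *)

Theorem theorem3p5 (R : realType) (n : nat) (H : riemannianManifold R n)
  (HH : hadamard H) (E : set H) (E0 : E !=set0) (Eopen : open E)
  (Econvex : geodesic_convex E) (l t : nat)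
  (phi : 'I_l -> H -> cintv R) (psi : 'I_t -> H -> R)
  (Fconvex : geodesic_convex (feasible E psi))
  (pbar : H) (Fpbar : feasible E psi pbar)
  (psi_convex : forall u, convex_at E (psi u) pbar)
  (psi_diff : forall u, dir_differentiable (psi u) pbar) :
  [/\ (exists c : 'I_l,
        [/\ LU_convex_at E (phi c) pbar,
            weakly_dir_differentiable (phi c) pbar &
            exists (lamL lamU : R) (mu : 'I_t -> R),
              [/\ 0 < lamL, 0 < lamU, forall u, 0 <= mu u,
                  forall p, feasible E psi p ->
                    0 <= lamL * dir_derive (intv_lo \o phi c) (exp_inv pbar p)
                       + lamU * dir_derive (intv_hi \o phi c) (exp_inv pbar p)
                       + \sum_(u < t)
                           mu u * dir_derive (psi u) (exp_inv pbar p) &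
                  forall u, mu u * psi u pbar = 0]]) ->
      weakly_typeI_Pareto (feasible E psi) phi pbar,
      (exists c : 'I_l,
        [/\ CW_convex_at E (phi c) pbar,
            weakly_dir_differentiable (phi c) pbar &
            exists (lamC lamW : R) (mu : 'I_t -> R),
              [/\ 0 < lamC, 0 < lamW, forall u, 0 <= mu u,
                  forall p, feasible E psi p ->
                    0 <= lamC * dir_derive (intv_center \o phi c) (exp_inv pbar p)
                       + lamW * dir_derive (intv_halfwidth \o phi c) (exp_inv pbar p)
                       + \sum_(u < t)
                           mu u * dir_derive (psi u) (exp_inv pbar p) &
                  forall u, mu u * psi u pbar = 0]]) ->
      weakly_typeII_Pareto (feasible E psi) phi pbar &
      (exists c : 'I_l,
        [/\ CW_convex_at E (phi c) pbar,
            weakly_dir_differentiable (phi c) pbar &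
            exists (lamL lamU : R) (mu : 'I_t -> R),
              [/\ 0 < lamL /\ 0 < lamU, forall u, 0 <= mu u, lamL < lamU,
                  forall p, feasible E psi p ->
                    0 <= lamL * dir_derive (intv_lo \o phi c) (exp_inv pbar p)
                       + lamU * dir_derive (intv_hi \o phi c) (exp_inv pbar p)
                       + \sum_(u < t)
                           mu u * dir_derive (psi u) (exp_inv pbar p) &
                  forall u, mu u * psi u pbar = 0]]) ->
      weakly_typeII_Pareto (feasible E psi) phi pbar].
Proof.
split=> -[c [cphi dphi [a [b [mu]]]]].
- move=> [a0 b0 mu0 stat compl]; split=> // -[q Fq dom].
  exact: (stationaryLU_not_dominated E _ psi (phi c) pbar q a b mu
    _ _ _ _ _ _ _ _ Fq (stat q Fq) (dom c)).
- move=> [a0 b0 mu0 stat compl]; split=> // -[q Fq dom].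
  exact: (stationaryCW_not_dominated E _ psi (phi c) pbar q a b mu
    _ _ _ _ _ _ _ _ Fq (stat q Fq) (dom c)).
- move=> [[a0 b0] mu0 ltab stat compl]; split=> // -[q Fq dom].
  apply: (stationaryCW_not_dominated E _ psi (phi c) pbar q (a + b) (b - a) mu
    _ _ _ _ _ _ _ _ Fq _ (dom c)) => //.
  + exact: addr_gt0.
  + by rewrite subr_gt0.
  + by rewrite dir_derive_weightsCW //; exact: stat.
Qed.
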